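(* Let $\mathcal{E}$ be an evolution algebra over $\mathbb{F}$ with $\mathcal{E}^2=\mathcal{E}$ and natural basis $B=\{v_1,\ldots,v_n\}$. Let $\Gamma=\Gamma(\mathcal{E},B)$ be its associated graph. Then the sequence of affine group schemes $$1\longrightarrow \mathbf{Diag}(\Gamma)\stackrel{\iota}{\longrightarrow}\mathbf{Aut}(\mathcal{E})\stackrel{\rho}{\longrightarrow}\mathsf{Aut}(\Gamma)$$ is exact (that is, for every unital commutative associative $\mathbb{F}$-algebra $R$, the homomorphism $\iota_R$ is injective and its image equals the kernel of $\rho_R$).
   Context: $\mathbb{F}$ is a field of arbitrary characteristic; all algebras over $\mathbb{F}$ other than the coefficient algebras $R$ are finite dimensional. $\mathrm{Alg}_{\mathbb{F}}$ is the category of unital commutative associative $\mathbb{F}$-algebras; an affine group scheme is a representable functor $\mathrm{Alg}_{\mathbb{F}}\to\mathrm{Grp}$. An algebra is a vector space with a bilinear multiplication (not assumed associative, commutative or unital). An evolution algebra is an algebra $\mathcal{E}$ endowed with a basis $B=\{v_1,\ldots,v_n\}$ (a natural basis) such that $v_iv_j=0$ for all $i\neq j$. Write $v_i^2=\sum_{j=1}^n\alpha_{ij}v_j$ with $\alpha_{ij}\in\mathbb{F}$. $\mathcal{E}^2$ is the span of all products; $\mathcal{E}^2=\mathcal{E}$ is equivalent to the matrix $(\alpha_{ij})$ being invertible. The associated directed graph $\Gamma=\Gamma(\mathcal{E},B)=(V,E)$ has $V=B$ and $E=\{(v_i,v_j)\mid\alpha_{ij}\neq0\}\subseteq V\times V$.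 $\mathbf{Diag}(\Gamma)(R)=\{\varphi:V\to R^\times\mid \varphi(w)=\varphi(v)^2\ \text{for all}\ (v,w)\in E\}$, with pointwise multiplication. $\mathbf{Aut}(\mathcal{E})(R)=\mathrm{Aut}(\mathcal{E}_R)$ is the group of $R$-algebra automorphisms of $\mathcal{E}_R=\mathcal{E}\otimes_{\mathbb{F}}R$. $\mathrm{Aut}(\Gamma)=\{\sigma\in S_n\mid (v_i,v_j)\in E\Rightarrow (v_{\sigma(i)},v_{\sigma(j)})\in E\}$ and $\mathsf{Aut}(\Gamma)$ is the constant group scheme attached to it: it is represented by $\mathbb{F}^{\mathrm{Aut}(\Gamma)}=\mathrm{Maps}(\mathrm{Aut}(\Gamma),\mathbb{F})$, with basis $\{\epsilon_\sigma\}$, where $\epsilon_\sigma(\tau)=1$ if $\tau=\sigma$ and $0$ otherwise, so $\mathsf{Aut}(\Gamma)(R)=\mathrm{Hom}_{\mathrm{Alg}_{\mathbb{F}}}(\mathbb{F}^{\mathrm{Aut}(\Gamma)},R)$. The homomorphism $\iota$: for $\varphi\in\mathbf{Diag}(\Gamma)(R)$, $\iota_R(\varphi)=\hat\varphi$ is the automorphism of $\mathcal{E}_R$ with $\hat\varphi(v_i)=\varphi(v_i)v_i$ for all $i$. The homomorphism $\rho$: for $\varphi\in\mathrm{Aut}(\mathcal{E}_R)$ write $\varphi(v_i)=\sum_{j=1}^n r_{ji}v_j$, $r=\det(r_{ij})\in R^\times$, and for $\sigma\in S_n$ put $e_\sigma^\varphi=\mathrm{sgn}(\sigma)\,r^{-1}r_{\sigma(1)1}\cdots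 r_{\sigma(n)n}$. When $\mathcal{E}^2=\mathcal{E}$, the $e_\sigma^\varphi$ are orthogonal idempotents of $R$ with sum $1$, and $e_\sigma^\varphi=0$ unless $\sigma\in\mathrm{Aut}(\Gamma)$. Then $\rho_R(\varphi)\in\mathrm{Hom}_{\mathrm{Alg}_{\mathbb{F}}}(\mathbb{F}^{\mathrm{Aut}(\Gamma)},R)$ is the algebra homomorphism $\epsilon_\sigma\mapsto e_\sigma^\varphi$. *)

(* Defs.v *)
From HB Require Import structures.
From mathcomp Require Import all_boot all_order all_algebra all_fingroup.
From mathcomp Require Import boolp.

Set Implicit Arguments.
Unset Strict Implicit.
Unset Printing Implicit Defensive.
Import GRing.Theory.
Local Open Scope ring_scope.

(* Unital commutative associative F-algebras are presented by their structure *)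
(* map; the zero ring is allowed, which is why comAlgType F is not used.      *)
Record commAlg (F : fieldType) := CommAlg {
  commAlg_ring :> comPzRingType;
  structure_map : {rmorphism F -> commAlg_ring} }.

Section Units.
Variable R : comPzRingType.

(* R^x, as the pairs of a unit and its inverse: unitRingType would exclude    *)
(* the zero ring and would require invertibility to be decidable.             *)
Record units := Units { unit_pair : R * R; _ : unit_pair.1 * unit_pair.2 == 1 }.

HB.instance Definition _ := [isSub for unit_pair].
HB.instance Definition _ := [Choice of units by <:].

Definition unit_val (u : units) : R := (unit_pair u).1.
Definition unit_inv (u : units) : R := (unit_pair u).2.

Lemma unit_valV u : unit_val u * unit_inv u = 1.
Proof. by case: u => p; rewrite /unit_val /unit_inv /= => /eqP. Qed.

Lemma unit_val_inj : injective unit_val.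
Proof.
move=> u w uw; have uV := unit_valV u; have wV := unit_valV w.
have iE : unit_inv u = unit_inv w.
  by rewrite -[LHS]mulr1 -wV mulrA -uw [unit_inv u * _]mulrC uV mul1r.
apply: val_inj; move: uw iE; rewrite /unit_val /unit_inv /=.
by case: (unit_pair u) (unit_pair w) => [a b] [c d] /= -> ->.
Qed.

Fact units_one_subproof : ((1, 1) : R * R).1 * ((1, 1) : R * R).2 == 1.
Proof. by rewrite mulr1. Qed.
Definition units_one := @Units ((1, 1) : R * R) units_one_subproof.

Fact units_mul_subproof (u w : units) :
  (unit_val u * unit_val w, unit_inv u * unit_inv w).1 *
  (unit_val u * unit_val w, unit_inv u * unit_inv w).2 == 1.
Proof. by rewrite /= mulrACA !unit_valV mulr1. Qed.
Definition units_mul u w := Units (units_mul_subproof u w).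

Fact units_inv_subproof (u : units) :
  (unit_inv u, unit_val u).1 * (unit_inv u, unit_val u).2 == 1.
Proof. by rewrite /= mulrC unit_valV. Qed.
Definition units_inv u := Units (units_inv_subproof u).

Fact units_mulA : associative units_mul.
Proof. by move=> u v w; apply: unit_val_inj; apply: mulrA. Qed.
Fact units_mul1 : left_id units_one units_mul.
Proof. by move=> u; apply: unit_val_inj; apply: mul1r. Qed.
Fact units_mulr1 : right_id units_one units_mul.
Proof. by move=> u; apply: unit_val_inj; apply: mulr1. Qed.
Fact units_mulV : left_inverse units_one units_inv units_mul.
Proof.
by move=> u; apply: unit_val_inj; have:= unit_valV u; rewrite mulrC.
Qed.
Fact units_mulrV : right_inverse units_one units_inv units_mul.
Proof. by move=> u; apply: unit_val_inj; apply: unit_valV. Qed.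

HB.instance Definition _ := isGroup.Build units
  units_mulA units_mul1 units_mulr1 units_mulV units_mulrV.

End Units.

Record evolutionAlgebra (F : fieldType) := EvolutionAlgebra {
  ev_sort :> vectType F;
  ev_mul : {bilinear ev_sort -> ev_sort -> ev_sort};
  ev_dim : nat;
  ev_basis : ev_dim.-tuple ev_sort;
  ev_basisP : basis_of fullv ev_basis;
  ev_natural : forall i j : 'I_ev_dim,
    i != j -> ev_mul (tnth ev_basis i) (tnth ev_basis j) = 0 }.

Section EvolutionAlgebra.
Variables (F : fieldType) (E : evolutionAlgebra F).
Local Notation n := (ev_dim E).

Definition ev_v (i : 'I_n) : E := tnth (ev_basis E) i.

(* the j-th coordinate of x in the natural basis *)
Definition ev_coord (j : 'I_n) (x : E) : F := coord (ev_basis E) j x.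

(* E^2, the span of all products, see ev_square_sub *)
Definition ev_square : {vspace E} :=
  <<[seq ev_mul E x y | x <- vbasis {:E}, y <- vbasis {:E}]>>%VS.

(* v_i^2 = \sum_j ev_alpha i j *: v_j *)
Definition ev_alpha (i j : 'I_n) : F := ev_coord j (ev_mul E (ev_v i) (ev_v i)).

(* The graph of E; the vertex v_i is represented by its index i. *)
Definition ev_edge : rel 'I_n := fun i j => ev_alpha i j != 0.

Definition ev_autGraph : {set {perm 'I_n}} :=
  [set s : {perm 'I_n} |
    [forall i, forall j, ev_edge i j ==> ev_edge (s i) (s j)]].

Lemma ev_autGraphP (s : {perm 'I_n}) :
  reflect (forall i j, ev_edge i j -> ev_edge (s i) (s j)) (s \in ev_autGraph).
Proof.
rewrite inE; apply: (iffP forallP) => h i; last first.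
  by apply/forallP=> j; apply/implyP/h.
by move=> j; move: (h i) => /forallP/(_ j)/implyP.
Qed.

Fact ev_autGraph_group : group_set ev_autGraph.
Proof.
apply/group_setP; split; first by apply/ev_autGraphP=> i j; rewrite !perm1.
move=> s t /ev_autGraphP hs /ev_autGraphP ht.
by apply/ev_autGraphP=> i j; rewrite !permM => /hs/ht.
Qed.
Canonical ev_autGraph_groupType := Group ev_autGraph_group.

Lemma ev_coordE x : x = \sum_j ev_coord j x *: ev_v j.
Proof.
rewrite [LHS](coord_basis (ev_basisP E) (memvf x)).
by apply: eq_bigr => j _; rewrite /ev_v (tnth_nth 0).
Qed.

Lemma ev_coord_v i j : ev_coord j (ev_v i) = (j == i)%:R.
Proof.
by rewrite /ev_coord /ev_v (tnth_nth 0) coord_free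
  ?(basis_free (ev_basisP E)) // eq_sym.
Qed.

Lemma ev_coordD j : {morph ev_coord j : x y / x + y}.
Proof. exact: linearD. Qed.
Lemma ev_coordZ j c x : ev_coord j (c *: x) = c * ev_coord j x.
Proof. exact: linearZ. Qed.
Lemma ev_coord_sum j I (r : seq I) P (f : I -> E) :
  ev_coord j (\sum_(i <- r | P i) f i) = \sum_(i <- r | P i) ev_coord j (f i).
Proof. exact: linear_sum. Qed.

Lemma ev_mulE x y :
  ev_mul E x y =
  \sum_i (ev_coord i x * ev_coord i y) *: ev_mul E (ev_v i) (ev_v i).
Proof.
rewrite {1}[x]ev_coordE linear_sumlz; apply: eq_bigr => i _.
rewrite linearZl_LR /= {1}[y]ev_coordE linear_sumr (bigD1 i) //= big1 => [|j ji].
  by rewrite addr0 linearZr_LR /= scalerA.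
by rewrite linearZr_LR /= ev_natural ?scaler0 // eq_sym.
Qed.

Lemma ev_square_sub (U : {vspace E}) :
  reflect (forall x y, ev_mul E x y \in U) (ev_square <= U)%VS.
Proof.
apply: (iffP span_subvP) => [h x y | h _ /allpairsP[[x y] [_ _ ->]]]; last exact: h.
rewrite [x](coord_vbasis (memvf x)) [y](coord_vbasis (memvf y)).
rewrite linear_sumlz; apply: memv_suml => i _; rewrite linear_sumr.
apply: memv_suml => j _; rewrite linearZl_LR linearZr_LR /=.
by do 2!apply: memvZ; apply/h/allpairsP; exists ((vbasis fullv)`_i, (vbasis fullv)`_j);
  split; rewrite //= mem_nth // size_tuple.
Qed.

End EvolutionAlgebra.

Section ScalarExtension.
Variables (F : fieldType) (E : evolutionAlgebra F) (R : commAlg F).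
Local Notation n := (ev_dim E).
Local Notation eta := (structure_map R).

(* E (x)_F R, realised as the free R-module on the natural basis;             *)
(* ext_tens_universal is its universal property and ext_mul_tens              *)
(* characterises its multiplication.                                          *)
Definition ext : Type := 'rV[R]_n.
HB.instance Definition _ := GRing.Lmodule.on ext.

(* x (x) a *)
Definition ext_tens (x : E) (a : R) : ext :=
  (\row_k (eta (ev_coord k x) * a) : 'rV[R]_n).

(* v_i (x) 1 *)
Definition ext_v (i : 'I_n) : ext := ext_tens (ev_v i) 1.

Definition ext_coord (j : 'I_n) (x : ext) : R := (x : 'rV[R]_n) 0 j.

(* The R-bilinear extension of the multiplication of E. *)
Definition ext_mul (x y : ext) : ext :=
  \sum_i \sum_j
    ext_tens (ev_mul E (ev_v i) (ev_v j)) (ext_coord i x * ext_coord j y).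

Lemma ext_coordP x y : (forall j, ext_coord j x = ext_coord j y) -> x = y.
Proof. by move=> h; apply/rowP. Qed.

Lemma ext_coordD j : {morph ext_coord j : x y / x + y}.
Proof. by move=> x y; rewrite /ext_coord mxE. Qed.
Lemma ext_coord0 j : ext_coord j 0 = 0.
Proof. by rewrite /ext_coord mxE. Qed.
Lemma ext_coordZ j (a : R) (x : ext) : ext_coord j (a *: x) = a * ext_coord j x.
Proof. by rewrite /ext_coord mxE. Qed.
Lemma ext_coord_sum j I (r : seq I) P (f : I -> ext) :
  ext_coord j (\sum_(i <- r | P i) f i) = \sum_(i <- r | P i) ext_coord j (f i).
Proof. by rewrite /ext_coord summxE. Qed.
Lemma ext_coord_tens j x a : ext_coord j (ext_tens x a) = eta (ev_coord j x) * a.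
Proof. by rewrite /ext_coord mxE. Qed.
Lemma ext_coord_v j i : ext_coord j (ext_v i) = (j == i)%:R.
Proof. by rewrite ext_coord_tens ev_coord_v rmorph_nat mulr1. Qed.

Lemma ext_coordE x : x = \sum_j ext_coord j x *: ext_v j.
Proof.
apply: ext_coordP => k; rewrite ext_coord_sum (bigD1 k) //= big1 => [|j jk].
  by rewrite addr0 ext_coordZ ext_coord_v eqxx mulr1.
by rewrite ext_coordZ ext_coord_v eq_sym (negPf jk) mulr0.
Qed.

Lemma ext_tensDl a : {morph ext_tens^~ a : x y / x + y}.
Proof.
by move=> x y; apply: ext_coordP => j;
  rewrite ext_coordD !ext_coord_tens ev_coordD rmorphD mulrDl.
Qed.
Lemma ext_tensDr x : {morph ext_tens x : a b / a + b}.
Proof.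
by move=> a b; apply: ext_coordP => j; rewrite ext_coordD !ext_coord_tens mulrDr.
Qed.
Lemma ext_tensZ c x a : ext_tens (c *: x) a = ext_tens x (eta c * a).
Proof.
by apply: ext_coordP => j; rewrite !ext_coord_tens ev_coordZ rmorphM mulrCA mulrA.
Qed.
Lemma ext_tensZr b x a : ext_tens x (b * a) = b *: ext_tens x a.
Proof. by apply: ext_coordP => j; rewrite ext_coordZ !ext_coord_tens mulrCA. Qed.

Lemma ext_tens_universal (M : lmodType R) (f : E -> M) :
    {morph f : x y / x + y} -> (forall c x, f (c *: x) = eta c *: f x) ->
  exists! g : ext -> M, linear g /\ forall x, g (ext_tens x 1) = f x.
Proof.
move=> fD fZ; exists (fun x => \sum_j ext_coord j x *: f (ev_v j)); split.
  split=> [a x y | x].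
    rewrite scaler_sumr -big_split; apply: eq_bigr => j _ /=.
    by rewrite ext_coordD ext_coordZ scalerDl scalerA.
  have f0 : f 0 = 0 by rewrite -(scale0r (0 : E)) fZ rmorph0 scale0r.
  rewrite [in RHS](ev_coordE x) (big_morph f fD f0).
  by apply: eq_bigr => j _; rewrite ext_coord_tens mulr1 fZ.
move=> g [gL gf]; apply: funext => x; rewrite [in RHS](ext_coordE x).
have gD : {morph g : x y / x + y}.
  by move=> y z; have := gL 1 y z; rewrite !scale1r.
have g0 : g 0 = 0 by apply: (addrI (g 0)); rewrite -gD !addr0.
rewrite (big_morph g gD g0); apply: eq_bigr => j _.
by rewrite -[X in g X]addr0 gL g0 addr0 gf.
Qed.

Lemma ext_coord_mul k x y : ext_coord k (ext_mul x y) =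
  \sum_i eta (ev_alpha i k) * (ext_coord i x * ext_coord i y).
Proof.
rewrite ext_coord_sum; apply: eq_bigr => i _.
rewrite ext_coord_sum (bigD1 i) //= big1 => [|j ji].
  by rewrite addr0 ext_coord_tens.
rewrite ext_coord_tens ev_natural ?(eq_sym i) // -(scale0r (0 : E)) ev_coordZ.
by rewrite mul0r rmorph0 mul0r.
Qed.

Lemma ext_mul_tens x y a b :
  ext_mul (ext_tens x a) (ext_tens y b) = ext_tens (ev_mul E x y) (a * b).
Proof.
apply: ext_coordP => k; rewrite ext_coord_mul ext_coord_tens ev_mulE.
rewrite ev_coord_sum rmorph_sum mulr_suml; apply: eq_bigr => i _.
rewrite !ext_coord_tens ev_coordZ !rmorphM mulrACA [RHS]mulrAC.
by rewrite [RHS]mulrC mulrA.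
Qed.

Lemma ext_mulC x y : ext_mul x y = ext_mul y x.
Proof.
apply: ext_coordP => k; rewrite !ext_coord_mul; apply: eq_bigr => i _.
by congr (_ * _); rewrite mulrC.
Qed.

Lemma ext_mul_linearl y : linear (ext_mul^~ y).
Proof.
move=> a x z; apply: ext_coordP => k.
rewrite ext_coordD ext_coordZ !ext_coord_mul mulr_sumr -big_split.
apply: eq_bigr => i _ /=; rewrite ext_coordD ext_coordZ mulrDl mulrDr.
by congr (_ + _); rewrite -mulrA mulrCA.
Qed.

Lemma ext_mul_linearr x : linear (ext_mul x).
Proof. by move=> a y z; rewrite !(ext_mulC x) ext_mul_linearl. Qed.

End ScalarExtension.

Section Diag.
Variables (F : fieldType) (E : evolutionAlgebra F) (R : commAlg F).
Local Notation n := (ev_dim E).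

Definition diag_pred : pred {ffun 'I_n -> units R} :=
  fun f => [forall i, forall j, ev_edge i j ==> (f j == (f i * f i)%g)].

(* The R-points of Diag(Gamma). *)
Record DiagPts := MkDiag {
  diag_val : {ffun 'I_n -> units R};
  _ : diag_pred diag_val }.

HB.instance Definition _ := [isSub for diag_val].
HB.instance Definition _ := [Choice of DiagPts by <:].

Lemma diag_predP (f : {ffun 'I_n -> units R}) :
  reflect (forall i j, ev_edge i j -> f j = (f i * f i)%g) (diag_pred f).
Proof.
apply: (iffP forallP) => h i.
  by move=> j ij; move: (h i) => /forallP/(_ j)/implyP/(_ ij)/eqP.
by apply/forallP=> j; apply/implyP => /h ->.
Qed.

Lemma units_mulC (u w : units R) : (u * w = w * u)%g.
Proof. by apply: unit_val_inj; apply: mulrC. Qed.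

Fact diag_group_closed : group_closed diag_pred.
Proof.
split=> [|f g /diag_predP hf /diag_predP hg]; apply/diag_predP => i j ij.
  by rewrite !ffunE mulg1.
rewrite !ffunE (hf _ _ ij) (hg _ _ ij) invgM -!mulgA; congr (_ * _)%g.
by rewrite units_mulC -mulgA; congr (_ * _)%g; apply: units_mulC.
Qed.

HB.instance Definition _ :=
  SubChoice_isSubGroup.Build _ _ DiagPts diag_group_closed.

End Diag.

Section Aut.
Variables (F : fieldType) (E : evolutionAlgebra F) (R : commAlg F).
Local Notation n := (ev_dim E).
Local Notation ext := (ext E R).

(* The R-points of Aut(E): the automorphisms of the R-algebra E_R, packaged   *)
(* with their inverse. *)
Record AutPts := MkAut {
  aut_fun :> ext -> ext;
  aut_inv : ext -> ext;
  aut_linear : linear aut_fun;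
  aut_morph : {morph aut_fun : x y / ext_mul x y};
  aut_funK : cancel aut_fun aut_inv;
  aut_invK : cancel aut_inv aut_fun }.

HB.instance Definition _ := gen_eqMixin AutPts.
HB.instance Definition _ := gen_choiceMixin AutPts.

Lemma aut_ext (f g : AutPts) : f =1 g -> f = g.
Proof.
move=> fg; have ig : aut_inv f =1 aut_inv g.
  by move=> x; rewrite -{1}(aut_invK g x) -fg aut_funK.
case: f g fg ig => f f' ? ? ? ? [g g' ? ? ? ?] /= /funext E1 /funext E2.
by subst; congr MkAut; apply: Prop_irrelevance.
Qed.

Definition aut_one : AutPts :=
  @MkAut id id (fun a u v => erefl) (fun x y => erefl)
    (fun x => erefl) (fun x => erefl).

Fact aut_mul_linear (f g : AutPts) : linear (f \o g).
Proof. by move=> a x y; rewrite /= !aut_linear. Qed.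
Fact aut_mul_morph (f g : AutPts) : {morph f \o g : x y / ext_mul x y}.
Proof. by move=> x y; rewrite /= !aut_morph. Qed.
Definition aut_mul (f g : AutPts) : AutPts :=
  MkAut (@aut_mul_linear f g) (@aut_mul_morph f g)
    (can_comp (aut_funK f) (aut_funK g)) (can_comp (aut_invK g) (aut_invK f)).

Fact aut_inv_linear (f : AutPts) : linear (aut_inv f).
Proof.
move=> a x y; apply: (can_inj (aut_funK f)).
by rewrite aut_linear !aut_invK.
Qed.
Fact aut_inv_morph (f : AutPts) : {morph aut_inv f : x y / ext_mul x y}.
Proof.
move=> x y; apply: (can_inj (aut_funK f)).
by rewrite aut_morph !aut_invK.
Qed.
Definition aut_V (f : AutPts) : AutPts :=
  MkAut (@aut_inv_linear f) (@aut_inv_morph f) (aut_invK f) (aut_funK f).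

Fact aut_mulA : associative aut_mul.
Proof. by move=> f g h; apply: aut_ext. Qed.
Fact aut_mul1 : left_id aut_one aut_mul.
Proof. by move=> f; apply: aut_ext. Qed.
Fact aut_mulr1 : right_id aut_one aut_mul.
Proof. by move=> f; apply: aut_ext. Qed.
Fact aut_mulV : left_inverse aut_one aut_V aut_mul.
Proof. by move=> f; apply: aut_ext => x /=; rewrite aut_funK. Qed.
Fact aut_mulrV : right_inverse aut_one aut_V aut_mul.
Proof. by move=> f; apply: aut_ext => x /=; rewrite aut_invK. Qed.

HB.instance Definition _ := isGroup.Build AutPts
  aut_mulA aut_mul1 aut_mulr1 aut_mulV aut_mulrV.

(* f (v_i) = \sum_j (aut_mx f) j i *: v_j *)
Definition aut_mx (f : AutPts) : 'M[R]_n :=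
  \matrix_(j, i) ext_coord j (f (ext_v R i)).

Lemma autD (f : AutPts) : {morph f : x y / x + y}.
Proof. by move=> x y; have := aut_linear f 1 x y; rewrite !scale1r. Qed.
Lemma aut0 (f : AutPts) : f 0 = 0.
Proof. by apply: (addrI (f 0)); rewrite -autD !addr0. Qed.
Lemma autZ (f : AutPts) a x : f (a *: x) = a *: f x.
Proof. by rewrite -[a *: x]addr0 aut_linear aut0 addr0. Qed.

Lemma ext_coord_aut k (f : AutPts) x :
  ext_coord k (f x) = \sum_j aut_mx f k j * ext_coord j x.
Proof.
rewrite [in LHS](ext_coordE x) (big_morph f (autD f) (aut0 f)) ext_coord_sum.
by apply: eq_bigr => j _; rewrite autZ ext_coordZ mxE mulrC.
Qed.

Lemma aut_mxM (f g : AutPts) : aut_mx (f * g)%g = aut_mx f *m aut_mx g.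
Proof.
apply/matrixP => j i; rewrite [LHS]mxE /= ext_coord_aut mxE.
by apply: eq_bigr => k _; rewrite [aut_mx g _ _]mxE.
Qed.

Lemma aut_mx1 : aut_mx 1%g = 1%:M.
Proof. by apply/matrixP => j i; rewrite !mxE ext_coord_v. Qed.

Fact aut_det_subproof (f : AutPts) :
  let p := (\det (aut_mx f), \det (aut_mx f^-1%g)) in p.1 * p.2 == 1.
Proof. by rewrite /= -det_mulmx -aut_mxM mulgV aut_mx1 det1. Qed.

(* r = \det (r_ij), as an element of R^x *)
Definition aut_det (f : AutPts) : units R := Units (aut_det_subproof f).

(* e_s^f = sgn(s) r^-1 r_(s 1)1 ... r_(s n)n *)
Definition aut_idem (f : AutPts) (s : {perm 'I_n}) : R :=
  (-1) ^+ s * unit_val (aut_det f)^-1%g * \prod_i aut_mx f (s i) i.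

End Aut.

Lemma big_subg (F : finGroupType) (G : {group F}) (V : nmodType) (f : F -> V) :
  \sum_(s : [subg G]) f (sgval s) = \sum_(s in G) f s.
Proof.
rewrite [RHS](reindex_onto sgval (subg G)) => [|s sG]; last exact: subgK.
by apply: eq_bigl => s; rewrite subgP sgvalK eqxx.
Qed.

Section ConstantGroupScheme.
Variables (F : fieldType) (T : finType) (G : {group {perm T}}) (R : commAlg F).
Local Notation eta := (structure_map R).
Local Notation FG := {ffun [subg G] -> F}.

(* The R-points Hom_Alg(F^G, R) of the constant group scheme G; the           *)
(* structure map of F^G sends c to the constant map c. *)
Record ConstPts := MkConst {
  const_fun :> FG -> R;
  const_zmod : zmod_morphism const_fun;
  const_monoid : GRing.monoid_morphism const_fun;
  const_structure : forall c : F, const_fun [ffun=> c] = eta c }.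

HB.instance Definition _ := gen_eqMixin ConstPts.
HB.instance Definition _ := gen_choiceMixin ConstPts.

Lemma const_ext (h k : ConstPts) : h =1 k -> h = k.
Proof.
case: h k => h ? ? ? [k ? ? ?] /= /funext E1.
by subst; congr MkConst; apply: Prop_irrelevance.
Qed.

Definition const_eps (s : [subg G]) : FG := [ffun t => (t == s)%:R].

(* In {perm T}, s * t is t o s; perm_comp s t is the composite s o t.         *)
Definition perm_comp (s t : [subg G]) : [subg G] := (t * s)%g.

Section OfFamily.
Variables (I : finType) (p : I -> [subg G]) (e : I -> R).
Hypothesis e_idem : forall i j, e i * e j = (i == j)%:R * e i.
Hypothesis e_sum : \sum_i e i = 1.

Definition const_of_fun (f : FG) : R := \sum_i eta (f (p i)) * e i.

Fact const_of_zmod : zmod_morphism const_of_fun.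
Proof.
move=> f g; rewrite /const_of_fun -sumrB; apply: eq_bigr => i _.
by rewrite !ffunE rmorphB mulrBl.
Qed.

Fact const_of_structure c : const_of_fun [ffun=> c] = eta c.
Proof.
rewrite -[RHS]mulr1 -e_sum mulr_sumr.
by apply: eq_bigr => i _; rewrite ffunE.
Qed.

Fact const_of_monoid : GRing.monoid_morphism const_of_fun.
Proof.
split=> [|f g]; first by rewrite -[1]/[ffun=> 1] const_of_structure rmorph1.
rewrite /const_of_fun mulr_suml; apply: eq_bigr => i _.
rewrite mulr_sumr (bigD1 i) //= big1 => [|j ji].
  by rewrite addr0 mulrACA e_idem eqxx mul1r ffunE rmorphM.
by rewrite mulrACA e_idem eq_sym (negPf ji) mul0r mulr0.
Qed.

Definition const_of : ConstPts :=
  MkConst const_of_zmod const_of_monoid const_of_structure.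

End OfFamily.

Lemma constB (h : ConstPts) : {morph h : f g / f - g}.
Proof. exact: const_zmod. Qed.
Lemma const0 (h : ConstPts) : h 0 = 0.
Proof. by rewrite -[0 in LHS](subrr 0) constB subrr. Qed.
Lemma constD (h : ConstPts) : {morph h : f g / f + g}.
Proof.
move=> f g; rewrite -[g in LHS]opprK constB -[- g]sub0r constB const0.
by rewrite opprB subr0.
Qed.
Lemma constM (h : ConstPts) : {morph h : f g / f * g}.
Proof. exact: (const_monoid h).2. Qed.
Lemma const1 (h : ConstPts) : h 1 = 1.
Proof. exact: (const_monoid h).1. Qed.

Lemma const_expand (f : FG) : f = \sum_s [ffun=> f s] * const_eps s.
Proof.
apply/ffunP => t; rewrite sum_ffunE (bigD1 t) //= big1 => [|s st].
  by rewrite !ffunE eqxx mulr1 addr0.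
by rewrite !ffunE eq_sym (negPf st) mulr0.
Qed.

Lemma constE (h : ConstPts) f : h f = \sum_s eta (f s) * h (const_eps s).
Proof.
rewrite {1}[f]const_expand (big_morph h (constD h) (const0 h)).
by apply: eq_bigr => s _; rewrite constM const_structure.
Qed.

Lemma const_eps_idem (h : ConstPts) s t :
  h (const_eps s) * h (const_eps t) = (s == t)%:R * h (const_eps s).
Proof.
rewrite -constM; case: eqP => [<-|st]; last first.
  rewrite mul0r -(const0 h); congr (h _); apply/ffunP => u; rewrite !ffunE.
  by case: eqP => [->|]; rewrite ?mul0r //; case: eqP; rewrite ?mulr0.
rewrite mul1r; congr (h _); apply/ffunP => u; rewrite !ffunE.
by case: eqP; rewrite ?mulr1 ?mulr0.
Qed.

Lemma const_eps_sum (h : ConstPts) : \sum_s h (const_eps s) = 1.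
Proof.
rewrite -(const1 h) constE; apply: eq_bigr => s _.
by rewrite ffunE rmorph1 mul1r.
Qed.

Lemma const_of_eps e (e_idem : forall i j, e i * e j = (i == j)%:R * e i)
    (e_sum : \sum_i e i = 1) s :
  const_of id e_idem e_sum (const_eps s) = e s.
Proof.
rewrite /= /const_of_fun (bigD1 s) //= big1 => [|t ts].
  by rewrite ffunE eqxx rmorph1 mul1r addr0.
by rewrite ffunE (negPf ts) rmorph0 mul0r.
Qed.

(* The group law is dual to the comultiplication                              *)
(* eps_s |-> \sum_(t o u = s) eps_t (x) eps_u of F^G.                         *)
Definition const_mul_fam (h k : ConstPts) (p : [subg G] * [subg G]) : R :=
  h (const_eps p.1) * k (const_eps p.2).

Fact const_mul_idem h k p q :
  const_mul_fam h k p * const_mul_fam h k q = (p == q)%:R * const_mul_fam h k p.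
Proof.
rewrite /const_mul_fam mulrACA !const_eps_idem mulrACA -natrM mulnb.
by case: p q => [a b] [c d].
Qed.

Fact const_mul_sum h k : \sum_p const_mul_fam h k p = 1.
Proof.
rewrite -(pair_bigA _ (fun s t => const_mul_fam h k (s, t))) /=.
rewrite -(const_eps_sum h); apply: eq_bigr => s _.
by rewrite /const_mul_fam /= -mulr_sumr const_eps_sum mulr1.
Qed.

Definition const_mul (h k : ConstPts) : ConstPts :=
  const_of (fun p : [subg G] * [subg G] => perm_comp p.1 p.2)
    (@const_mul_idem h k) (const_mul_sum h k).

Fact const_one_zmod : zmod_morphism (fun f : FG => eta (f 1%g)).
Proof. by move=> f g; rewrite !ffunE rmorphB. Qed.
Fact const_one_monoid : GRing.monoid_morphism (fun f : FG => eta (f 1%g)).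
Proof. by split=> [|f g]; rewrite ffunE ?rmorph1 ?rmorphM. Qed.
Fact const_one_structure (c : F) : eta ([ffun=> c] (1%g : [subg G])) = eta c.
Proof. by rewrite ffunE. Qed.
Definition const_one : ConstPts :=
  MkConst const_one_zmod const_one_monoid const_one_structure.

Definition const_inv (h : ConstPts) : ConstPts :=
  const_of (fun s => s^-1%g) (const_eps_idem h) (const_eps_sum h).

Lemma const_mulE h k f :
  const_mul h k f =
  \sum_s \sum_t eta (f (perm_comp s t)) * (h (const_eps s) * k (const_eps t)).
Proof. by rewrite pair_bigA. Qed.

Lemma const_mulEl h k f :
  const_mul h k f =
  \sum_t h [ffun s => f (perm_comp s t)] * k (const_eps t).
Proof.
rewrite const_mulE exchange_big; apply: eq_bigr => t _.
rewrite (constE h) mulr_suml; apply: eq_bigr => s _.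
by rewrite ffunE mulrA.
Qed.

Lemma const_mulEr h k f :
  const_mul h k f =
  \sum_s h (const_eps s) * k [ffun t => f (perm_comp s t)].
Proof.
rewrite const_mulE; apply: eq_bigr => s _.
rewrite (constE k) mulr_sumr; apply: eq_bigr => t _.
by rewrite ffunE mulrCA.
Qed.

Fact const_mulA : associative const_mul.
Proof.
move=> h k l; apply: const_ext => f.
rewrite const_mulEr const_mulEl.
under eq_bigr => s _ do rewrite const_mulEl mulr_sumr.
rewrite exchange_big; apply: eq_bigr => t _.
rewrite const_mulEr mulr_suml; apply: eq_bigr => s _.
rewrite -mulrA; congr (_ * (k _ * _)); apply/ffunP => u.
by rewrite !ffunE /perm_comp mulgA.
Qed.

Fact const_mul1 : left_id const_one const_mul.
Proof.
move=> h; apply: const_ext => f; rewrite const_mulEl constE.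
by apply: eq_bigr => s _; rewrite /= ffunE /perm_comp mulg1.
Qed.

Fact const_mulr1 : right_id const_one const_mul.
Proof.
move=> h; apply: const_ext => f; rewrite const_mulEr constE.
by apply: eq_bigr => s _; rewrite /= ffunE /perm_comp mul1g mulrC.
Qed.

Lemma const_inv_eps h s : const_inv h (const_eps s) = h (const_eps s^-1%g).
Proof.
rewrite /= /const_of_fun (bigD1 s^-1%g) //= big1 => [|t ts].
  by rewrite ffunE invgK eqxx rmorph1 mul1r addr0.
by rewrite ffunE -(can_eq invgK) invgK (negPf ts) rmorph0 mul0r.
Qed.

Fact const_mulV : left_inverse const_one const_inv const_mul.
Proof.
move=> h; apply: const_ext => f; rewrite const_mulE exchange_big.
rewrite -[RHS]mulr1 -[const_one f]/(eta (f 1%g)) -(const_eps_sum h).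
rewrite mulr_sumr; apply: eq_bigr => t _.
rewrite (bigD1 t^-1%g) // big1 => [|s st].
  by rewrite Monoid.mulm1 const_inv_eps ?invgK const_eps_idem ?invgK eqxx mul1r
    /perm_comp mulgV.
rewrite const_inv_eps const_eps_idem -(can_eq invgK) invgK (negPf st).
by rewrite mul0r mulr0.
Qed.

Fact const_mulrV : right_inverse const_one const_inv const_mul.
Proof.
move=> h; apply: const_ext => f; rewrite const_mulE.
rewrite -[RHS]mulr1 -[const_one f]/(eta (f 1%g)) -(const_eps_sum h).
rewrite mulr_sumr; apply: eq_bigr => s _.
rewrite (bigD1 s^-1%g) // big1 => [|t ts].
  by rewrite Monoid.mulm1 const_inv_eps ?invgK const_eps_idem ?invgK eqxx mul1r /perm_comp mulVg.
rewrite const_inv_eps const_eps_idem -(can_eq invgK s) invgK eq_sym (negPf ts).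
by rewrite mul0r mulr0.
Qed.

HB.instance Definition _ := isGroup.Build ConstPts
  const_mulA const_mul1 const_mulr1 const_mulV const_mulrV.

End ConstantGroupScheme.

Section Iota.
Variables (F : fieldType) (E : evolutionAlgebra F) (R : commAlg F).
Local Notation n := (ev_dim E).
Local Notation eta := (structure_map R).
Implicit Types f g : DiagPts E R.

(* The R-linear map v_i |-> f (v_i) v_i. *)
Definition iota_fun (f : {ffun 'I_n -> units R}) (x : ext E R) : ext E R :=
  \sum_i (ext_coord i x * unit_val (f i)) *: ext_v R i.

Lemma ext_coord_iota (f : {ffun 'I_n -> units R}) k x :
  ext_coord k (iota_fun f x) = ext_coord k x * unit_val (f k).
Proof.
rewrite ext_coord_sum (bigD1 k) //= big1 => [|i ik].
  by rewrite addr0 ext_coordZ ext_coord_v eqxx mulr1.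
by rewrite ext_coordZ ext_coord_v eq_sym (negPf ik) mulr0.
Qed.

Fact iota_linear (f : {ffun 'I_n -> units R}) : linear (iota_fun f).
Proof.
move=> a x y; apply: ext_coordP => k.
rewrite ext_coordD ext_coordZ !ext_coord_iota ext_coordD ext_coordZ.
by rewrite mulrDl mulrA.
Qed.

Fact iota_morph f : {morph iota_fun (val f) : x y / ext_mul x y}.
Proof.
move=> x y; apply: ext_coordP => k.
rewrite ext_coord_iota !ext_coord_mul mulr_suml; apply: eq_bigr => i _.
rewrite !ext_coord_iota; have [-> | ik] := eqVneq (ev_alpha i k) 0.
  by rewrite rmorph0 !mul0r.
have /diag_predP/(_ _ _ ik) -> := valP f.
by rewrite -mulrA; congr (_ * _); rewrite mulrACA.
Qed.

Fact iota_funK f : cancel (iota_fun (val f)) (iota_fun (val f^-1%g)).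
Proof.
move=> x; apply: ext_coordP => k; rewrite !ext_coord_iota /= ffunE.
by rewrite -mulrA unit_valV mulr1.
Qed.

Fact iota_invK f : cancel (iota_fun (val f^-1%g)) (iota_fun (val f)).
Proof. by have := iota_funK f^-1%g; rewrite invgK. Qed.

Definition iota_hom f : AutPts E R :=
  MkAut (iota_linear (val f)) (iota_morph f) (iota_funK f) (iota_invK f).

Lemma iotaE f i : iota_hom f (ext_v R i) = unit_val (val f i) *: ext_v R i.
Proof.
apply: ext_coordP => k; rewrite ext_coord_iota ext_coordZ ext_coord_v.
by case: eqP => [->|]; rewrite ?mulr1 ?mul1r ?mul0r ?mulr0.
Qed.

Fact iota_mul : {morph iota_hom : f g / (f * g)%g}.
Proof.
move=> f g; apply: aut_ext => x; apply: ext_coordP => k.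
by rewrite /= !ext_coord_iota /= ffunE -mulrA [RHS]mulrA mulrAC mulrA.
Qed.
Fact iota_one : iota_hom 1%g = 1%g.
Proof.
by apply: aut_ext => x; apply: ext_coordP => k; rewrite ext_coord_iota ffunE mulr1.
Qed.
HB.instance Definition _ :=
  isUMagmaMorphism.Build (DiagPts E R) (AutPts E R) iota_hom
  (pair iota_one iota_mul).

End Iota.

Section Rho.
Variables (F : fieldType) (E : evolutionAlgebra F).
Hypothesis E_perfect : ev_square E = fullv.
Variable R : commAlg F.
Local Notation n := (ev_dim E).
Local Notation eta := (structure_map R).
Local Notation G := (ev_autGraph_groupType E).
Implicit Types (f g : AutPts E R) (s t : {perm 'I_n}).

Lemma ev_alpha_inv :
  exists c : 'M[F]_n, (\matrix_(i < n, j < n) ev_alpha i j) *m c = 1%:M.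
Proof.
pose U := (\sum_i <[ev_mul E (ev_v i) (ev_v i)]>)%VS.
have UE x : x \in U.
  have /ev_square_sub : forall x y, ev_mul E x y \in U.
    move=> y z; rewrite ev_mulE; apply: memv_suml => i _; apply: memvZ.
    by apply: (subvP (sumv_sup i _ (subvv _))) => //; apply: memv_line.
  by rewrite E_perfect => /subvP; apply; apply: memvf.
have cP j : exists c : {ffun 'I_n -> F},
    ev_v j == \sum_i c i *: ev_mul E (ev_v i) (ev_v i).
  have /memv_sumP[u uU ->] := UE (ev_v j).
  have /all_sig[c cE] i : {a | u i = a *: ev_mul E (ev_v i) (ev_v i)}.
    by apply: cid; apply/vlineP/uU.
  by exists (finfun c); apply/eqP/eq_bigr => i _; rewrite ffunE.
exists (\matrix_(j, i) xchoose (cP j) i); apply: mulmx1C.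
apply/matrixP => j k; rewrite !mxE.
have /eqP/(congr1 (ev_coord k)) := xchooseP (cP j).
rewrite ev_coord_v ev_coord_sum eq_sym => ->; apply: eq_bigr => i _.
by rewrite !mxE ev_coordZ.
Qed.

Lemma ext_mul_v (i j k : 'I_n) : ext_coord k (ext_mul (ext_v R i) (ext_v R j)) =
  (i == j)%:R * eta (ev_alpha i k).
Proof.
rewrite ext_coord_mul (bigD1 i) //= big1 => [|l li].
  by rewrite !ext_coord_v eqxx mul1r addr0 mulrC.
by rewrite !ext_coord_v (negPf li) mul0r mulr0.
Qed.

Lemma aut_mx_orth f j i k : i != k -> aut_mx f j i * aut_mx f j k = 0.
Proof.
move=> ik; have [c cE] := ev_alpha_inv.
have s0 l : \sum_m eta (ev_alpha m l) * (aut_mx f m i * aut_mx f m k) = 0.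
  have v0 : ext_mul (ext_v R i) (ext_v R k) = 0.
    by apply: ext_coordP => m; rewrite ext_mul_v (negPf ik) mul0r ext_coord0.
  have := aut_morph f (ext_v R i) (ext_v R k); rewrite v0 aut0.
  move/(congr1 (ext_coord l)); rewrite ext_coord0 ext_coord_mul => E0.
  by rewrite [RHS]E0; apply: eq_bigr => m _; rewrite !mxE.
have -> : aut_mx f j i * aut_mx f j k =
    \sum_l eta (c l j) * \sum_m eta (ev_alpha m l) * (aut_mx f m i * aut_mx f m k).
  have xE m (x : R) :
      \sum_l eta (c l j) * (eta (ev_alpha m l) * x) = (m == j)%:R * x.
    have /matrixP/(_ m j)/(congr1 eta) := cE; rewrite !mxE rmorph_nat => <-.
    rewrite rmorph_sum mulr_suml; apply: eq_bigr => l _.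
    by rewrite !mxE rmorphM mulrA [_ * eta (c l j)]mulrC.
  under eq_bigr => l _ do rewrite mulr_sumr.
  rewrite exchange_big; under eq_bigr => m _ do rewrite xE.
  rewrite (bigD1 j) //= big1 => [|m /negPf ->]; last by rewrite mul0r.
  by rewrite eqxx mul1r addr0.
by apply: big1 => l _; rewrite s0 mulr0.
Qed.

Let P f s : R := \prod_i aut_mx f (s i) i.

Lemma aut_mx_prod f s i k : k != s i -> aut_mx f k i * P f s = 0.
Proof.
move=> ki; rewrite /P (bigD1 (s^-1%g k)) //= permKV mulrA aut_mx_orth ?mul0r //.
by apply: contra ki => /eqP ->; rewrite permKV.
Qed.

Lemma aut_mx_prodr f s j l : l != j -> aut_mx f (s j) l * P f s = 0.
Proof.
by move=> lj; apply: aut_mx_prod; rewrite (inj_eq perm_inj) eq_sym.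
Qed.

Lemma aut_prod_orth f s t : s != t -> P f s * P f t = 0.
Proof.
move=> st; have [i si] : exists i, s i != t i.
  by apply/existsP; apply: contraR st => /existsPn h; apply/eqP/permP => i;
    apply/eqP/negPn.
by rewrite {1}/P (bigD1 i) //= mulrAC aut_mx_prod ?mul0r.
Qed.

Lemma aut_idem_sum f : \sum_s aut_idem f s = 1.
Proof.
rewrite -(unit_valV (aut_det f)) {1}/unit_val /= -det_tr /determinant mulr_suml.
apply: eq_bigr => s _; rewrite /aut_idem mulrAC; congr (_ * _ * _).
by apply: eq_bigr => i _; rewrite [RHS]mxE.
Qed.

Lemma aut_idem_orth f s t :
  aut_idem f s * aut_idem f t = (s == t)%:R * aut_idem f s.
Proof.
have o s' t' : s' != t' -> aut_idem f s' * aut_idem f t' = 0.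
  by move=> st; rewrite /aut_idem mulrACA aut_prod_orth ?mulr0.
have [<- | /o ->] := eqVneq s t; last by rewrite mul0r.
rewrite mul1r -[RHS]mulr1 -(aut_idem_sum f) mulr_sumr (bigD1 s) //= big1 ?addr0 //.
by move=> u us; rewrite o // eq_sym.
Qed.

Lemma aut_idem0 f s : s \notin ev_autGraph E -> aut_idem f s = 0.
Proof.
rewrite inE => /forallPn[i /forallPn[j]]; rewrite negb_imply => /andP[ij].
rewrite negbK => /eqP sij.
have /(congr1 (ext_coord (s j))) := aut_morph f (ext_v R i) (ext_v R i).
rewrite ext_coord_aut ext_coord_mul => /(congr1 ( *%R^~ (P f s))).
rewrite !mulr_suml (bigD1 j) //= [in LHS]big1 => [|l lj]; last first.
  by rewrite mulrAC aut_mx_prodr ?mul0r.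
rewrite addr0 [RHS](bigD1 (s i)) //= sij rmorph0 !mul0r add0r big1 => [|m mi].
  rewrite ext_mul_v eqxx mul1r mulrAC => /(congr1 ( *%R^~ (eta (ev_alpha i j)^-1))).
  rewrite mul0r -[_ * eta (_^-1)]mulrA -(rmorphM eta) mulfV // rmorph1 mulr1 => P0.
  have PP : P f s * P f s = 0 by rewrite {1}/P (bigD1 j) //= mulrAC P0 mul0r.
  have := aut_idem_orth f s s; rewrite eqxx mul1r => <-.
  by rewrite /aut_idem mulrACA -/(P f s) PP mulr0.
have := aut_mx_prod f mi; rewrite [aut_mx _ _ _]mxE => m0.
by rewrite -!mulrA m0 !mulr0.
Qed.

Lemma prod_absorb (I : finType) (x y : I -> R) p :
  (forall i, x i * p = y i * p) -> (\prod_i x i) * p = (\prod_i y i) * p.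
Proof.
move=> xy; pose K (a b : R) := a * p = b * p; rewrite -/(K _ _).
apply: (big_ind2 K) => [|a b c d|i _]; rewrite /K ?xy // => ab cd.
by rewrite -mulrA cd mulrCA ab mulrA [d * b]mulrC.
Qed.

Lemma aut_idemM f g s :
  aut_idem (f * g)%g s = \sum_t aut_idem f (t^-1 * s)%g * aut_idem g t.
Proof.
rewrite -[LHS]mulr1 -(aut_idem_sum g) mulr_sumr; apply: eq_bigr => t _.
have gt : aut_idem g t = aut_idem g t * aut_idem g t.
  by rewrite aut_idem_orth eqxx mul1r.
have PE : P (f * g)%g s * P g t = P f (t^-1 * s)%g * P g t * P g t.
  rewrite -[RHS]mulrA; have -> : P f (t^-1 * s)%g = \prod_i aut_mx f (s i) (t i).
    rewrite /P (reindex_inj (@perm_inj _ t)); apply: eq_bigr => i _.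
    by rewrite permM permK.
  rewrite mulrA; have -> : \prod_i aut_mx f (s i) (t i) * P g t =
      \prod_i (aut_mx f (s i) (t i) * aut_mx g (t i) i) by rewrite big_split.
  apply: prod_absorb => i.
  rewrite aut_mxM mxE mulr_suml (bigD1 (t i)) //= big1 ?addr0 // => k ki.
  by rewrite -mulrA aut_mx_prod ?mulr0.
rewrite [in RHS]gt /aut_idem -/(P g t) -/(P f _) -/(P (f * g)%g s).
have -> : unit_val (aut_det (f * g)%g)^-1%g =
    unit_val (aut_det f)^-1%g * unit_val (aut_det g)^-1%g.
  have -> : aut_det (f * g)%g = (aut_det f * aut_det g)%g.
    by apply: unit_val_inj; rewrite -[LHS]/(\det (aut_mx (f * g)%g)) aut_mxM det_mulmx.
  by rewrite invgM units_mulC.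
have -> : (-1) ^+ s = (-1) ^+ (t^-1 * s)%g * (-1) ^+ t :> R.
  rewrite odd_permM odd_permV addbC; case: (odd_perm s) (odd_perm t) => [] [] /=;
  by rewrite ?expr0 ?expr1 ?mulr1 ?mul1r // mulrNN mulr1.
set a := (-1) ^+ (t^-1 * s)%g; set b := (-1) ^+ t.
set u := unit_val _; set v := unit_val _.
have -> : a * b * (u * v) * P (f * g)%g s * (b * v * P g t) =
    a * b * (u * v) * (b * v) * (P (f * g)%g s * P g t) by rewrite mulrACA.
rewrite PE; move: (P f _) (P g t) => p q.
rewrite -!mulrA; congr (_ * _).
rewrite !(mulrCA _ u); congr (_ * _).
rewrite !(mulrCA _ p); congr (_ * _).
by rewrite (mulrCA q b) (mulrCA q v).
Qed.

Fact rho_idem f (s t : [subg G]) :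
  aut_idem f (sgval s) * aut_idem f (sgval t) =
  (s == t)%:R * aut_idem f (sgval s).
Proof. by rewrite aut_idem_orth (inj_eq val_inj). Qed.

Fact rho_sum f : \sum_(s : [subg G]) aut_idem f (sgval s) = 1.
Proof.
rewrite (big_subg G (aut_idem f)) -(aut_idem_sum f) [RHS](bigID (mem G)) /=.
by rewrite [X in _ + X]big1 ?addr0 // => s; apply: aut_idem0.
Qed.

(* The algebra map eps_s |-> e_s^f, see rho_eps. *)
Definition rho_hom f : ConstPts G R := const_of id (@rho_idem f) (rho_sum f).

Lemma rho_eps f (s : [subg G]) : rho_hom f (const_eps F s) = aut_idem f (sgval s).
Proof. exact: const_of_eps. Qed.


Fact rho_mul : {morph rho_hom : f g / (f * g)%g}.
Proof.
move=> f g; apply: const_ext => h; rewrite [RHS]const_mulE exchange_big.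
have gE s : aut_idem (f * g)%g s =
    \sum_(t : [subg G]) aut_idem f ((sgval t)^-1 * s)%g * aut_idem g (sgval t).
  rewrite (big_subg G (fun t => aut_idem f (t^-1 * s)%g * aut_idem g t)) aut_idemM.
  rewrite (bigID (mem G)) /= [X in _ + X]big1 ?addr0 // => t tG.
  by rewrite (aut_idem0 g tG) mulr0.
rewrite -[LHS]/(\sum_(s : [subg G]) eta (h s) * aut_idem (f * g)%g (sgval s)).
under [LHS]eq_bigr => s _ do rewrite gE mulr_sumr.
rewrite [LHS]exchange_big; apply: eq_bigr => t _; rewrite [LHS](reindex_inj (mulgI t)).
apply: eq_bigr => s _; rewrite !rho_eps /perm_comp.
by congr (_ * (aut_idem f _ * _)); apply: mulKg.
Qed.

Fact rho_one : rho_hom 1%g = 1%g.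
Proof. by apply: (mulgI (rho_hom 1%g)); rewrite -rho_mul !mulg1. Qed.

HB.instance Definition _ :=
  isUMagmaMorphism.Build (AutPts E R) (ConstPts G R) rho_hom
  (pair rho_one rho_mul).

End Rho.

(* Main.v *)
(** Both membership in the image of iota and triviality under rho amount to the
    matrix of the automorphism being diagonal. For iota, multiplicativity on
    v_i^2 gives the edge condition. For rho, triviality means e_1 = 1, and e_1,
    a multiple of the product of the diagonal entries, is killed by every
    off-diagonal entry, since distinct entries of a row multiply to 0. *)

Require Import Defs.
From HB Require Import structures.
From mathcomp Require Import all_boot all_order all_algebra all_fingroup.

Set Implicit Arguments.
Unset Strict Implicit.
Unset Printing Implicit Defensive.
Import GRing.Theory.
Local Open Scope ring_scope.

Section Exactness.
Variables (F : fieldType) (E : evolutionAlgebra F) (R : commAlg F).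
Local Notation n := (ev_dim E).
Local Notation eta := (structure_map R).
Implicit Types f : AutPts E R.

Lemma iota_inj : injective (@iota_hom F E R).
Proof.
move=> g h gh; apply/val_inj/ffunP => i; apply: unit_val_inj.
have := congr1 (fun f : AutPts E R => ext_coord i (f (ext_v R i))) gh.
by rewrite /= !ext_coord_iota ext_coord_v eqxx !mul1r.
Qed.

Section DiagonalAut.
Variable f : AutPts E R.
Hypothesis f_diag : is_diag_mx (aut_mx f).

Lemma ext_coord_aut_diag k x :
  ext_coord k (f x) = aut_mx f k k * ext_coord k x.
Proof.
rewrite ext_coord_aut (bigD1 k) //= big1 ?addr0 // => j jk.
by rewrite (is_diag_mxP f_diag) ?mul0r // eq_sym.
Qed.

(** Only [f] is known to be diagonal, which suffices: the i-th coordinate of [f (f^-1 v_i) = v_i] is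
    the product of the two diagonal entries. *)
Fact aut_diag_unit_subproof i :
  (aut_mx f i i, aut_mx f^-1%g i i).1 * (aut_mx f i i, aut_mx f^-1%g i i).2 == 1.
Proof.
rewrite /= [aut_mx f^-1%g _ _]mxE -ext_coord_aut_diag [f _](aut_invK f).
by rewrite ext_coord_v eqxx.
Qed.

Definition aut_diag : {ffun 'I_n -> units R} :=
  [ffun i => Units (aut_diag_unit_subproof i)].

Fact aut_diag_pred : diag_pred aut_diag.
Proof.
apply/diag_predP => i j ij; rewrite !ffunE; apply: unit_val_inj.
have /(congr1 (ext_coord j)) := aut_morph f (ext_v R i) (ext_v R i).
rewrite ext_coord_aut_diag ext_mul_v eqxx mul1r ext_coord_mul (bigD1 i) //=.
rewrite big1 => [|k ki]; last first.
  by rewrite ext_coord_aut_diag ext_coord_v (negPf ki) !(mulr0, mul0r).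
rewrite addr0 !ext_coord_aut_diag ext_coord_v eqxx mulr1 mulrC.
(* The edge makes [ev_alpha i j] nonzero in the field [F], so its image in [R] is cancellable even
   if [R] has zero divisors. *)
move/(congr1 ( *%R (eta (ev_alpha i j)^-1))); rewrite !mulrA -rmorphM mulVf //.
by rewrite rmorph1 !mul1r.
Qed.

Lemma iota_aut_diag : iota_hom (MkDiag aut_diag_pred) = f.
Proof.
apply: aut_ext => x; apply: ext_coordP => k.
by rewrite ext_coord_aut_diag /= ext_coord_iota ffunE mulrC.
Qed.

End DiagonalAut.

Lemma im_iota_diag f :
  (exists g : DiagPts E R, iota_hom g = f) <-> is_diag_mx (aut_mx f).
Proof.
split=> [[g <-] | f_diag]; last by exists (MkDiag (aut_diag_pred f_diag));
  apply: iota_aut_diag.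
apply/is_diag_mxP => i j ij.
by rewrite mxE /= ext_coord_iota ext_coord_v -val_eqE (negPf ij) mul0r.
Qed.

Hypothesis E_perfect : ev_square E = fullv.

(** The trivial point is evaluation at the identity, sending [const_eps] of s to 1 or 0. Once e_1 =
    1, orthogonality gives e_s = e_1 e_s = 0 for all other s. *)
Lemma rho_eq1 f : rho_hom E_perfect f = 1%g <-> aut_idem f 1%g = 1.
Proof.
split=> [f1 | e1].
  by rewrite -[LHS](rho_eps E_perfect f 1%g) f1 /= ffunE eqxx rmorph1.
apply: const_ext => h; rewrite !constE; apply: eq_bigr => s _; congr (_ * _).
rewrite rho_eps /= ffunE -[LHS]mul1r -e1 aut_idem_orth // e1 mulr1 rmorph_nat.
by rewrite -(inj_eq val_inj).
Qed.

Lemma aut_idem1_diag f : aut_idem f 1%g = 1 <-> is_diag_mx (aut_mx f).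
Proof.
split=> [e1 | f_diag].
  apply/is_diag_mxP => k i ki; rewrite -[LHS]mulr1 -e1 mulrCA.
  by rewrite aut_mx_prod ?mulr0 // perm1.
(* For a diagonal matrix the product of the diagonal entries is the determinant r, so e_1 = r^-1
   r. *)
rewrite /aut_idem odd_perm1 expr0 mul1r -[RHS](unit_valV (aut_det f)) [RHS]mulrC.
congr (_ * _); rewrite [RHS]/unit_val /= det_trig; last first.
  exact: is_diag_mx_is_trig.
by apply: eq_bigr => i _; rewrite perm1.
Qed.

End Exactness.

Theorem theorem3p2 (F : fieldType) (E : evolutionAlgebra F)
    (E_perfect : ev_square E = fullv%VS) (R : commAlg F) :
  injective (@iota_hom F E R) /\
  (forall f : AutPts E R,
     (exists g : DiagPts E R, iota_hom g = f) <-> rho_hom E_perfect f = 1%g).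
Proof.
split=> [|f]; first exact: iota_inj.
by rewrite im_iota_diag rho_eq1 aut_idem1_diag.
Qed.
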